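(* If $(X,T)$ is a transitive system with the multiple IP-recurrence property, then $(X,T)$ is either equicontinuous or sensitive.
   Context: A (topological) dynamical system $(X,T)$ consists of a (nonempty) compact metric space $(X,\rho)$ and a continuous map $T\colon X\to X$. $\mathbb{N}$ is the set of positive integers. $(X,T)$ is transitive if for every two non-empty open $U,V\subset X$ there is $n\in\mathbb{N}$ with $T^nU\cap V\ne\emptyset$. $(X,T)$ is equicontinuous if for every $\varepsilon>0$ there is $\delta>0$ such that $\rho(x,y)<\delta$ implies $\rho(T^nx,T^ny)<\varepsilon$ for all $n=0,1,2,\dots$. $(X,T)$ is sensitive if there is $\delta>0$ such that for every $x\in X$ and every neighborhood $U$ of $x$ there exist $y\in U$ and $n\in\mathbb{N}$ with $\rho(T^nx,T^ny)>\delta$. $(X,T)$ has the multiple IP-recurrence property if for every non-empty open $U\subset X$, every $d\ge1$ and all sequences $\{p_i^{(1)}\}_{i=1}^\infty,\dots,\{p_i^{(d)}\}_{i=1}^\infty$ in $\mathbb{N}$ (generating the IP-sets $FS\{p_i^{(j)}\}_{i=1}^\infty$ of all sums $\sum_{i\in\alpha}p_i^{(j)}$ over non-empty finite $\alpha\subset\mathbb{N}$), there exists a non-empty finite subset $\alpha$ of $\mathbb{N}$ such that \[U\cap T^{-\sum_{i\in\alpha}p_i^{(1)}}U\cap T^{-\sum_{i\in\alpha}p_i^{(2)}}U\cap\dots\cap T^{-\sum_{i\in\alpha}p_i^{(d)}}U\ne\emptyset.\] *)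

(* Defs.v *)
From HB Require Import structures.
From mathcomp Require Import all_boot all_order all_algebra finmap.
From mathcomp Require Import all_classical all_reals all_analysis.

Set Implicit Arguments.
Unset Strict Implicit.
Unset Printing Implicit Defensive.

Import Order.TTheory GRing.Theory Num.Theory.

Local Open Scope classical_set_scope.
Local Open Scope ring_scope.

Definition transitive_system (X : topologicalType) (T : X -> X) : Prop :=
  forall U V : set X, open U -> U !=set0 -> open V -> V !=set0 ->
    exists n : nat, (0 < n)%N /\ (iter n T @` U) `&` V !=set0.

(* Uniform in the base point, unlike the pointwise [equicontinuous] of
   MathComp-Analysis. *)
Definition equicontinuous_system (R : realType) (X : metricType R)
    (T : X -> X) : Prop :=
  forall e : R, 0 < e -> exists d : R, 0 < d /\
    forall x y : X, mdist x y < d ->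
      forall n : nat, mdist (iter n T x) (iter n T y) < e.

Definition sensitive_system (R : realType) (X : metricType R)
    (T : X -> X) : Prop :=
  exists d : R, 0 < d /\
    forall (x : X) (U : set X), nbhs x U ->
      exists y : X, U y /\
        exists n : nat, (0 < n)%N /\ d < mdist (iter n T x) (iter n T y).

(* Sequences are indexed from 0 instead of 1; their terms are positive. *)
Definition multiple_IP_recurrence (X : topologicalType) (T : X -> X) : Prop :=
  forall U : set X, open U -> U !=set0 ->
    forall d : nat, (0 < d)%N ->
      forall p : 'I_d -> nat -> nat, (forall j i, (0 < p j i)%N) ->
        exists alpha : {fset nat}, alpha != fset0 /\
          U `&` \bigcap_(j in [set: 'I_d])
            (iter (\sum_(i <- alpha) p j i)%N T @^-1` U) !=set0.

(* Main.v *)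
Require Import Defs.
From HB Require Import structures.
From mathcomp Require Import all_boot all_order all_algebra finmap.
From mathcomp Require Import all_classical all_reals all_analysis.
From mathcomp Require Import lra zify.

(** Suppose that the system is not sensitive.  The heart of the matter is that
    every orbit is then dense ([orbit_dense_of_not_sensitive]).

    Failure of sensitivity provides, for every [r > 0], a nonempty open set
    whose positive iterates all have diameter less than [r].  By transitivity
    every ball [B(x, r)] contains a nonempty open set [V] whose iterates [T^n V]
    have diameter less than [r] for all [n >= m], with some fixed [m]: pull such
    a stable set back along an iterate.  If [n >= m] and [T^n V] meets [V], then
    [T^n V] lies in [B(x, 2r)].  Now suppose that the orbit of some [z] stays
    outside [B(x, 4r)].  By transitivity points of [V] come so close to [z] that
    they follow its orbit for as long as desired, hence stay outside [B(x, 2r)]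
    during arbitrarily long intervals of times.  So the times [n] for which
    [T^n V] is disjoint from [V] form a thick set.  A thick set contains an
    IP-set ([thick_contains_IP]), and [V] does not return along this IP-set,
    which contradicts recurrence along single IP-sequences.

    Equicontinuity follows ([equicontinuous_of_dense_orbits]).  Given [e], every
    orbit enters an open set whose iterates stay of diameter less than [e];
    hence each point has a neighbourhood of which all iterates are small, and
    compactness makes the size of these neighbourhoods uniform. *)

Set Implicit Arguments.
Unset Strict Implicit.
Unset Printing Implicit Defensive.

Import Order.TTheory GRing.Theory Num.Theory.

Local Open Scope classical_set_scope.
Local Open Scope ring_scope.

(** A greedy choice: if the sums of the earlier terms are at most [s], take as
    the next term the left end of an interval of length [s] inside the thick
    set.  Every finite sum then lies in the interval that belongs to its largest
    index. *)
Lemma thick_contains_IP (F : set nat) :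
  (forall k, exists n, (0 < n)%N /\ forall i, (i <= k)%N -> F (n + i)%N) ->
  exists p : nat -> nat, (forall i, (0 < p i)%N) /\
    forall a : {fset nat}, a != fset0 -> F (\sum_(i <- a) p i)%N.
Proof.
move=> /choice[f fP].
(* [S i] is the sum of all terms of index less than [i]. *)
pose S i := iter i (fun s => s + f s)%N 0%N.
exists (fun i => f (S i)); split=> [i|]; first by have [] := fP (S i).
have sumP N : forall a : {fset nat}, (forall i, i \in a -> (i < N)%N) ->
    (\sum_(i <- a) f (S i) <= S N)%N /\
    (a != fset0 -> F (\sum_(i <- a) f (S i))%N).
  elim: N => [a alt|N IH a alt].
    suff -> : a = fset0 by rewrite big_seq_fset0.
    by apply/fsetP => i; rewrite inE; apply/negP => /alt.
  have rest (b : {fset nat}) : (forall i, i \in b -> i \in a /\ i != N) ->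
      forall i, i \in b -> (i < N)%N.
    by move=> sub i /sub[/alt]; rewrite ltnS leq_eqVlt => /orP[->|].
  have [Na|Na] := boolP (N \in a); last first.
    have [|le_a Fa] := IH a.
      by apply: rest => i ia; split=> //; apply: contraNneq Na => <-.
    by split=> //; rewrite (leq_trans le_a)//= leq_addr.
  rewrite (big_fsetD1 N Na)/=.
  have [|le_b _] := IH (a `\ N)%fset.
    by apply: rest => i; rewrite !inE => /andP[-> ->].
  split; first by rewrite addnC leq_add2r.
  by move=> _; have [_] := fP (S N); apply.
move=> a; apply: (sumP (\max_(i <- a) i).+1 a _).2 => i ia.
by rewrite ltnS; exact: leq_bigmax_seq.
Qed.

Section Dynamics.
Context (R : realType) (X : metricType R) (T : X -> X).

Lemma near_mdist (x : X) (e : R) : 0 < e -> \forall y \near x, mdist x y < e.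
Proof. by move=> e0; have := nbhsx_ballx x _ e0; rewrite ballEmdist. Qed.

(** Otherwise [e / 3] would witness sensitivity.  The loss of a constant factor
    comes from passing from distances to the centre of a neighbourhood to
    distances between two of its points. *)
Lemma stable_open_of_not_sensitive (e : R) : ~ sensitive_system T -> 0 < e ->
  exists W : set X, [/\ open W, W !=set0 &
    forall y y' n, W y -> W y' -> (0 < n)%N ->
      mdist (iter n T y) (iter n T y') < e].
Proof.
move=> nsens e0; apply: contrapT => nW; apply: nsens.
exists (e / 3); split; first by lra.
move=> x U xU; apply: contrapT => nU; apply: nW; exists U°; split.
- exact: open_interior.
- by exists x.
have close y n : U° y -> (0 < n)%N -> mdist (iter n T x) (iter n T y) <= e / 3.
  move=> Uy n0; rewrite leNgt; apply/negP => lt_e; apply: nU.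
  by exists y; split; [exact: interior_subset Uy|exists n].
move=> y y' n Uy Uy' n0.
have := metric_triangle (iter n T y) (iter n T x) (iter n T y').
have := close _ _ Uy n0; have := close _ _ Uy' n0.
rewrite (metric_sym (iter n T y) (iter n T x)); lra.
Qed.

Hypothesis T_continuous : continuous T.

Lemma continuous_iter n : continuous (iter n T).
Proof.
elim: n => [|n IH] x; first exact: cvg_id.
apply: (@continuous_comp _ _ _ (iter n T) T); first exact: IH.
exact: T_continuous.
Qed.

Lemma near_iter_mdist (z : X) (k : nat) (r : R) : 0 < r ->
  \forall w \near z, forall i, (i <= k)%N ->
    mdist (iter i T z) (iter i T w) < r.
Proof.
move=> r0; elim: k => [|k IH].
  by near=> w => i; rewrite leqn0 => /eqP -> /=; near: w; exact: near_mdist.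
have Tk := continuous_iter (near_mdist (iter k.+1 T z) r0).
near=> w => i; rewrite leq_eqVlt => /orP[/eqP ->|].
  by near: w; exact: Tk.
by rewrite ltnS; move: i; near: w.
Unshelve. all: by end_near. Qed.

Hypothesis T_transitive : transitive_system T.

(** The iterates of [V] are controlled only from time [m] on: [V] reaches a
    stable set, which may lie far away from [U], at a time less than [m]. *)
Lemma eventually_stable_subset (U : set X) (e : R) :
    ~ sensitive_system T -> open U -> U !=set0 -> 0 < e ->
  exists V m, [/\ open V, V !=set0, V `<=` U &
    forall y y' n, V y -> V y' -> (m <= n)%N ->
      mdist (iter n T y) (iter n T y') < e].
Proof.
move=> nsens oU U0 e0.
have [W [oW W0 Wst]] := stable_open_of_not_sensitive nsens e0.
have [k [k0 [_ [[u Uu <-] Wu]]]] := T_transitive oU U0 oW W0.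
exists (U `&` iter k T @^-1` W), k.+1; split.
- apply: openI => //; apply: open_comp => // x _; exact: continuous_iter.
- by exists u.
- by move=> ? [].
move=> y y' n [_ Wy] [_ Wy'] kn.
by rewrite -(subnK (ltnW kn)) !iterD; apply: Wst => //; rewrite subn_gt0.
Qed.

(** If the orbit of [z] avoided [U], points of a small [V] inside [U] would
    shadow this orbit for arbitrarily long, and the times [n] at which [T^n V]
    misses [V] would form a thick set, hence contain an IP-set. *)
Lemma orbit_dense_of_not_sensitive (U : set X) (z : X) :
    ~ sensitive_system T -> multiple_IP_recurrence T ->
  open U -> U !=set0 -> exists i, U (iter i T z).
Proof.
move=> nsens T_IP oU [x Ux]; apply: contrapT => nz.
have [r r0 rU] : exists2 r, 0 < r & forall y, mdist x y < 4 * r -> U y.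
  have [s s0 sU] := (nbhs_ballP x U).1 (open_nbhs_nbhs (conj oU Ux)).
  exists (s / 4) => [|y xy]; first by move: s0 => /=; lra.
  by apply: sU; rewrite ballEmdist /=; lra.
have far i : 4 * r <= mdist x (iter i T z).
  by rewrite leNgt; apply/negP => /rU Uz; apply: nz; exists i.
have B0 : (ball x r)° !=set0 by exists x; apply: nbhsx_ballx.
have [V [m [oV V0 VB Vst]]] :=
  eventually_stable_subset nsens (@open_interior _ (ball x r)) B0 r0.
have Vx y : V y -> mdist x y < r.
  by move=> /VB/interior_subset; rewrite ballEmdist.
have thick k : exists n, (0 < n)%N /\ forall i, (i <= k)%N ->
    ~ (V `&` iter (n + i) T @^-1` V !=set0).
  pose W := [set w | forall i, (i <= m + k)%N ->
    mdist (iter i T z) (iter i T w) < r].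
  have W0 : W° !=set0 by exists z; apply: near_iter_mdist.
  have [l [l0 [_ [[v Vv <-] /interior_subset Wv]]]] :=
    T_transitive oV V0 (@open_interior _ W) W0.
  (* The first [m] times are skipped, so that stability of [V] applies. *)
  exists (l + m)%N; split=> [|i ik [y [Vy Vny]]]; first by rewrite ltn_addr.
  have := Wv (m + i)%N; rewrite leq_add2l -iterD => /(_ ik).
  rewrite (addnC (m + i)%N) addnA.
  have mn : (m <= l + m + i)%N by lia.
  have := Vst _ _ _ Vy Vv mn; have := Vx _ Vny; rewrite /=.
  move: (far (m + i)%N).
  set zi := iter (m + i) T z; set yn := iter _ T y; set vn := iter _ T v.
  have := metric_triangle x vn zi; have := metric_triangle x yn vn.
  by rewrite (metric_sym vn zi); lra.
have [p [p0 pP]] := @thick_contains_IP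
  (fun n => ~ (V `&` iter n T @^-1` V !=set0)) thick.
have [a [a0 [y [Vy Vny]]]] := T_IP V oV V0 1%N isT (fun=> p) (fun=> p0).
by apply: (pP a a0); exists y; split=> //; exact: (Vny ord0).
Qed.

(** Near a point whose orbit enters a stable set [W] at time [i], all iterates
    are small: up to time [i] by continuity, and afterwards by stability. *)
Lemma equicontinuous_of_dense_orbits :
    compact [set: X] -> ~ sensitive_system T ->
    (forall U z, open U -> U !=set0 -> exists i, U (iter i T z)) ->
  equicontinuous_system T.
Proof.
move=> cX nsens dense e e0.
have [W [oW W0 Wst]] := stable_open_of_not_sensitive nsens e0.
pose P (d : R) (x : X) := forall y, mdist x y < d ->
  forall n, mdist (iter n T x) (iter n T y) < e.
have : \forall d \near 0^'+, [set: X] `<=` P d.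
  apply: ((compact_near_coveringP _).1 cX) => z _.
  have [i Wi] := dense W z oW W0.
  have near_z : \forall w \near z, W (iter i T w) /\
      forall j, (j <= i)%N -> mdist (iter j T z) (iter j T w) < e / 2.
    near=> w; split; near: w; last by apply: near_iter_mdist; lra.
    by apply: continuous_iter; apply: open_nbhs_nbhs.
  have [s /= s0 sP] := (nbhs_ballP _ _).1 near_z.
  near=> x d => y /= xy n.
  have zx : mdist z x < s / 2.
    by near: x; apply: near_mdist; rewrite divr_gt0.
  have ds : d <= s / 2.
    by near: d; apply: nbhs_right_le; rewrite divr_gt0.
  have [Wx xs] : W (iter i T x) /\
      forall j, (j <= i)%N -> mdist (iter j T z) (iter j T x) < e / 2.
    by apply: sP; rewrite ballEmdist /=; lra.
  have [Wy ys] : W (iter i T y) /\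
      forall j, (j <= i)%N -> mdist (iter j T z) (iter j T y) < e / 2.
    by apply: sP; rewrite ballEmdist /=; have := metric_triangle z x y; lra.
  have [ni|ni] := leqP n i.
    have := metric_triangle (iter n T x) (iter n T z) (iter n T y).
    rewrite (metric_sym (iter n T x) (iter n T z)).
    by have := xs _ ni; have := ys _ ni; lra.
  by rewrite -(subnK (ltnW ni)) !iterD; apply: Wst => //; rewrite subn_gt0.
move=> nearP; near (0 : R)^'+ => d.
exists d; split=> [|x y]; first by near: d; exact: nbhs_right_gt.
have /(_ x I) : [set: X] `<=` P d by near: d.
exact.
Unshelve. all: by end_near. Qed.

End Dynamics.

Local Close Scope ring_scope.

Theorem theorem5p2 (R : realType) (X : metricType R) (T : X -> X)
    (X_nonempty : [set: X] !=set0) (X_compact : compact [set: X])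
    (T_continuous : continuous T)
    (T_transitive : transitive_system T)
    (T_IP : multiple_IP_recurrence T) :
  equicontinuous_system T \/ sensitive_system T.
Proof.
have [|nsens] := pselect (sensitive_system T); [by right|left].
apply: equicontinuous_of_dense_orbits => // U z oU U0.
exact: orbit_dense_of_not_sensitive.
Qed.
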